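(* Let $G$ be a finite, simple, connected graph, let $r\ge 1$, and let $\Omega$ be a minimum strong geodetic set of $P_r\,\square\, G$. If $r > {\rm diam}(G)\binom{|\Omega|}{2} + |\Omega|$, then ${\rm sg}(P_r\,\square\, G) \geq \lceil 2\sqrt{|V(G)|}\, \rceil$.
   Context: $P_r$ is the path on vertex set $\{1,\dots,r\}$. For a graph $G=(V,E)$ and $S\subseteq V$, for each pair $\{x,y\}\subseteq S$ with $x\neq y$ let $\widetilde{P}(x,y)$ be a selected fixed shortest $x,y$-path, and let $\widetilde{I}(S)=\{\widetilde{P}(x,y): x,y\in S\}$. $S$ is a strong geodetic set if for some such choice of geodesics, every vertex of $G$ lies on some path of $\widetilde{I}(S)$. A minimum strong geodetic set is one of smallest cardinality; this cardinality is the strong geodetic number ${\rm sg}(G)$. The Cartesian product $G\,\square\, H$ has vertex set $V(G)\times V(H)$, with $(g,h)$ adjacent to $(g',h')$ iff either $g=g'$ and $hh'\in E(H)$, or $h=h'$ and $gg'\in E(G)$. ${\rm diam}(G)$ is the maximum distance between vertices of $G$. *)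

(* Defs.v *)
From mathcomp Require Import all_boot boolp.

Set Implicit Arguments.
Unset Strict Implicit.
Unset Printing Implicit Defensive.

Section Graphs.

Variables (T : finType) (e : rel T).
Implicit Types (x y : T) (s : seq T) (S : {set T}).

Definition simple_graph : Prop := symmetric e /\ irreflexive e.

Definition connected_graph : Prop := forall x y, connect e x y.

Definition has_walk x y (n : nat) : bool :=
  [exists p : n.-tuple T, path e x p && (last x p == y)].

(* In a connected graph the least length of a walk from x to y is below #|T|,
   so the search succeeds; the value is #|T| when y is unreachable from x. *)
Definition dist x y : nat := find (has_walk x y) (iota 0 #|T|).

Definition diam : nat := \max_(x : T) \max_(y : T) dist x y.

(* s lists all the vertices of the path, both ends included. *)
Definition geodesic x y s : Prop :=
  exists p, [/\ s = x :: p, path e x p, last x p = y & size p = dist x y].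

(* The equation P y x = rev (P x y) says that a single geodesic is selected
   for the unordered pair {x, y}.  The case x = y only allows the trivial
   path [:: x]; it matters only for the one-vertex graph, whose strong geodetic
   number is thus 1. *)
Definition geodesic_choice S (P : T -> T -> seq T) : Prop :=
  forall x y, x \in S -> y \in S ->
    geodesic x y (P x y) /\ P y x = rev (P x y).

Definition strong_geodetic_set S : Prop :=
  exists2 P : T -> T -> seq T, geodesic_choice S P &
    forall v : T, exists x y, [/\ x \in S, y \in S & v \in P x y].

Definition minimum_strong_geodetic_set S : Prop :=
  strong_geodetic_set S /\
  forall S' : {set T}, strong_geodetic_set S' -> #|S| <= #|S'|.

(* The minimum is meaningful for connected graphs, where [set: T] is a strong
   geodetic set. *)
Definition sg : nat :=
  #|[arg min_(S < [set: T] | `[< strong_geodetic_set S >]) #|S| ]|.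

End Graphs.

Definition cart_prod (T1 T2 : finType) (e1 : rel T1) (e2 : rel T2) :
    rel (T1 * T2) :=
  [rel u v | (u.1 == v.1) && e2 u.2 v.2 || (u.2 == v.2) && e1 u.1 v.1].

(* The vertices 1, ..., r are represented by 0, ..., r - 1. *)
Definition path_graph (r : nat) : rel 'I_r :=
  [rel i j : 'I_r | (i.+1 == j :> nat) || (j.+1 == i :> nat)].

Arguments path_graph : clear implicits.

(* Main.v *)
(** The vertices of a geodesic of [P_r □ G] have monotone first coordinates,
    and the geodesic has at most [diam G] edges inside the layers [{i} □ G].
    When [r > diam G * C(n, 2) + n] with [n = #|Omega|], some layer [c] thus
    contains no vertex of [Omega] and no edge of a selected geodesic.  A selected
    geodesic meets this layer at most once, and only if its ends lie strictly on
    opposite sides of it; if [l] vertices of [Omega] lie on one side, this gives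
    [#|V(G)| <= l * (n - l) <= n ^ 2 / 4]. *)

Require Import Defs.
From mathcomp Require Import all_boot all_order all_algebra.
From mathcomp Require Import boolp reals.
From mathcomp Require Import zify.

Set Implicit Arguments.
Unset Strict Implicit.
Unset Printing Implicit Defensive.

(** * Distances and minimum sets in an arbitrary graph *)

Lemma dist_le_size (T : finType) (e : rel T) x p :
  path e x p -> dist e x (last x p) <= size p.
Proof.
move=> xp; rewrite /dist; case: (leqP #|T| (size p)) => [|lt_p].
  by apply: leq_trans; rewrite -[leqRHS](size_iota 0) find_size.
rewrite leqNgt; apply/negP => /(before_find 0).
rewrite nth_iota // add0n => /negbT/negP; apply.
by apply/existsP; exists (in_tuple p); rewrite xp eqxx.
Qed.

Lemma dist_walk (T : finType) (e : rel T) x y :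
  connect e x y -> exists p, [/\ path e x p, last x p = y & size p = dist e x y].
Proof.
(* A duplicate-free walk has fewer than [#|T|] edges, so its length lies in the range searched by
   [dist]. *)
case/connectP=> _ /shortenP[p xp up _] Dy.
have lt_p : size p < #|T|.
  by rewrite -[(size p).+1]/(size (x :: p)) -(card_uniqP up) max_card.
have : has (has_walk e x y) (iota 0 #|T|).
  apply/hasP; exists (size p); first by rewrite mem_iota.
  by apply/existsP; exists (in_tuple p); rewrite xp Dy eqxx.
move=> has_p; have := nth_find 0 has_p; rewrite has_find size_iota in has_p.
rewrite nth_iota // add0n => /existsP[q /andP[xq /eqP Dq]].
by exists q; split=> //; apply: size_tuple.
Qed.

Lemma dist_le_diam (T : finType) (e : rel T) x y : dist e x y <= diam e.
Proof.
by apply: leq_trans (leq_bigmax x); apply: (leq_bigmax (F := dist e x) y).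
Qed.

Lemma sg_minimum (T : finType) (e : rel T) (S : {set T}) :
  minimum_strong_geodetic_set e S -> sg e = #|S|.
Proof.
case=> gS minS; rewrite /sg /arg_min /extremum.
case: pickP => [A /= /andP[/asboolP gA /forallP minA] | /(_ S) /=].
  apply/eqP; rewrite eqn_leq minS // andbT.
  by apply: (implyP (minA S)); apply/asboolP.
(* The default of [arg min] is excluded: [S] itself is a minimizer. *)
case/negP; apply/andP; split; first exact/asboolP.
by apply/forallP => A; apply/implyP => /asboolP; apply: minS.
Qed.

(** * Walks and geodesics in the product with a path *)

Section Layers.

Variables (r : nat) (T : finType) (e : rel T).
Notation V := ('I_r * T)%type.
Notation E := (cart_prod (path_graph r) e).
Implicit Types (u v x y : V) (p : seq V) (c : 'I_r).

(* The layers, with multiplicity, of the edges of [u :: p] coming from [G]. *)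
Fixpoint stays u p : seq 'I_r :=
  if p is v :: q then (if u.1 == v.1 then [:: u.1] else [::]) ++ stays v q
  else [::].

Lemma stays_cat u p1 p2 :
  stays u (p1 ++ p2) = stays u p1 ++ stays (last u p1) p2.
Proof. by elim: p1 u => //= v p1 IH u; rewrite IH catA. Qed.

Lemma size_stays u p : size (stays u p) <= size p.
Proof.
elim: p u => //= v p IH u; rewrite size_cat.
by have := IH v; case: (_ == _) => /=; lia.
Qed.

Lemma cart_path_cases u v : E u v ->
  u.1 = v.1 /\ e u.2 v.2 \/
  [/\ u.2 = v.2, (u.1 == v.1) = false
    & u.1.+1 = v.1 :> nat \/ v.1.+1 = u.1 :> nat].
Proof.
case/orP=> /andP[/eqP Duv uv]; [by left | right].
have d : u.1.+1 = v.1 :> nat \/ v.1.+1 = u.1 :> nat.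
  by case/orP: uv => /eqP; [left | right].
by split=> //; apply/eqP => /(congr1 val) /=; lia.
Qed.

(** Projecting to [G] keeps the edges inside layers and collapses the others, which leaves a walk of
    length [size (stays u p)]. *)
Lemma dist_le_stays u p :
  path E u p -> dist e u.2 (last u p).2 <= size (stays u p).
Proof.
move=> up; suff [q [uq <- <-]] : exists q,
  [/\ path e u.2 q, last u.2 q = (last u p).2 & size q = size (stays u p)].
  exact: dist_le_size.
elim: p u up => [|v p IH] u /=; first by exists [::].
case/andP=> /cart_path_cases uv /IH[q [vq lq sq]].
case: uv => [[-> uv]|[-> -> _]]; last by exists q.
by exists (v.2 :: q); rewrite eqxx /= uv sq.
Qed.

(** An edge between layers raises the first coordinate by at most 1, and an edge inside a layer does
    not change it. *)
Lemma last_stays_le u p :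
  path E u p -> (last u p).1 + size (stays u p) <= u.1 + size p.
Proof.
elim: p u => [|v p IH] u //= /andP[/cart_path_cases uv /IH].
by case: uv => [[-> _]|[_ -> d]]; rewrite ?eqxx /=; lia.
Qed.

(* This relation is transitive, so that along a path with no edge inside layer
   [c] at most one vertex lies in layer [c]. *)
Definition crosses c : rel V :=
  [rel u v : V | (u.1 < v.1) || (u.1 == v.1) && (u.1 != c)].

Lemma crosses_trans c : transitive (crosses c).
Proof.
rewrite /crosses => v u w /=.
case/orP=> [uv | /andP[/eqP -> vc]] /orP[vw | /andP[/eqP Dvw wc]].
- by rewrite (ltn_trans uv vw).
- by rewrite -Dvw uv.
- by rewrite vw.
- by rewrite Dvw eqxx -Dvw vc orbT.
Qed.

(** The inequality forces equality in [last_stays_le], so every edge between layers ascends; the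
    remaining edges avoid layer [c]. *)
Lemma path_crosses c u p : path E u p ->
  u.1 + size p <= (last u p).1 + size (stays u p) ->
  c \notin stays u p -> path (crosses c) u p.
Proof.
elim: p u => [|v p IH] u //= /andP[/cart_path_cases uv vp].
have := last_stays_le vp.
case: uv => [[Duv _]|[_ -> d]].
  rewrite Duv eqxx /= inE negb_or => _ le_p /andP[vc cp].
  rewrite {1}/crosses /= Duv eqxx eq_sym vc orbT /=; apply: IH => //; lia.
move=> ge_p le_p cp; have uv : u.1 < v.1 by move: ge_p le_p => /=; lia.
rewrite {1}/crosses /= uv /=; apply: IH => //; move: le_p => /=; lia.
Qed.

Lemma path_layer u (b : 'I_r) : u.1 <= b ->
  exists p, [/\ path E u p, last u p = (b, u.2) & size p = b - u.1].
Proof.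
case: u => a g /= le_ab.
elim: {a le_ab}(b - a) {-2}a (erefl (b - a)) le_ab => [|n IH] a Dn le_ab.
  by exists [::]; split=> //=; congr (_, _); apply: val_inj => /=; lia.
have lt_a : a.+1 < r by have := ltn_ord b; lia.
have [|| p [ap lp sp]] := IH (Ordinal lt_a); rewrite /=; [lia | lia |].
exists ((Ordinal lt_a, g) :: p); split=> //; last by rewrite /= sp /=; lia.
by rewrite /= ap /cart_prod /path_graph /= !eqxx /= orbT.
Qed.

Hypothesis conn_e : connected_graph e.

Lemma dist_cart_le u v : u.1 <= v.1 -> dist E u v <= v.1 - u.1 + dist e u.2 v.2.
Proof.
move=> /path_layer[p [up lp <-]].
have [q [uq lq <-]] := dist_walk (conn_e u.2 v.2).
(* Move first along the path factor to layer [v.1], then along a geodesic of [G] inside that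
   layer. *)
pose p' := p ++ [seq (v.1, g) | g <- q].
have -> : v = last u p'.
  by rewrite last_cat lp (last_map (pair v.1)) lq; case: (v).
have <- : size p' = size p + size q by rewrite size_cat size_map.
apply: dist_le_size; rewrite cat_path up lp.
elim: q {p p' lq up lp} u.2 uq => //= h q IH g /andP[gh /IH ->].
by rewrite /cart_prod /= eqxx gh.
Qed.

Lemma geodesic_stays x y s : geodesic E x y s -> x.1 <= y.1 ->
  size (stays x (behead s)) <= diam e.
Proof.
case=> p [-> xp Dy sp] le_xy; have := dist_cart_le le_xy.
have := last_stays_le xp; have := dist_le_diam e x.2 y.2.
by rewrite -sp Dy /=; lia.
Qed.

Lemma geodesic_crosses c x y s : geodesic E x y s -> x.1 <= y.1 ->
  c \notin stays x (behead s) -> sorted (crosses c) s.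
Proof.
case=> p [-> xp Dy sp] le_xy; have := dist_cart_le le_xy.
have := dist_le_stays xp; rewrite -sp Dy => ge_d le_p cp.
by apply: path_crosses => //; rewrite Dy; move: ge_d le_p => /=; lia.
Qed.

Lemma geodesic_between x y s v : geodesic E x y s -> x.1 <= y.1 ->
  v \in s -> x.1 <= v.1 <= y.1.
Proof.
case=> p [-> xp Dy sp] le_xy.
have := dist_cart_le le_xy; have := dist_le_stays xp.
rewrite -sp Dy => le_d le_p /splitPl vp; case: vp xp Dy le_d le_p => p1 p2 <-.
rewrite cat_path last_cat stays_cat !size_cat => /andP[xp1 vp2] Dy.
have := last_stays_le xp1; have := last_stays_le vp2; rewrite Dy.
(* Minimal total length forces equality in [last_stays_le] on both pieces, and [size_stays] then
   shows that neither piece descends. *)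
have := size_stays x p1; have := size_stays (last x p1) p2.
by move=> /=; lia.
Qed.

Lemma sorted_crosses_inj c s g h : sorted (crosses c) s ->
  (c, g) \in s -> (c, h) \in s -> g = h.
Proof.
move=> cs gs hs; pose v0 := (c, g).
have le_index u w : u \in s -> w \in s -> u.1 = c -> w.1 = c ->
    index w s <= index u s.
  (* If [u] came before [w], transitivity would make [crosses c] relate two vertices of layer
     [c]. *)
  move=> us ws Du Dw; rewrite leqNgt; apply/negP => lt_uw.
  have := sorted_ltn_nth (@crosses_trans c) v0 cs.
  move=> /(_ (index u s) (index w s)); rewrite !inE !index_mem !nth_index //.
  by move=> /(_ us ws lt_uw); rewrite /crosses /= Du Dw ltnn eqxx.
have Dgh : index (c, g) s = index (c, h) s.
  by apply/eqP; rewrite eqn_leq !le_index.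
by have := nth_index v0 gs; rewrite Dgh nth_index // => -[].
Qed.

(** * Counting layers and pairs for a strong geodetic set *)

Variable Omega : {set V}.
Variable P : V -> V -> seq V.
Hypothesis choiceP : geodesic_choice E Omega P.

(** Each unordered pair occurs at most once. Pairs within one layer can be left out: their geodesics
    stay in that layer, which meets [Omega]. *)
Definition ascents : {set V * V} :=
  [set xy in setX Omega Omega | xy.1.1 < xy.2.1].

Lemma card_ascents : #|ascents| <= 'C(#|Omega|, 2).
Proof.
pose f (xy : V * V) := [set xy.1; xy.2].
have injf : {in ascents &, injective f}.
  move=> [x y] [x' y']; rewrite !inE /= => /andP[_ lt1] /andP[_ lt2] /setP eqf.
  have := eqf x; have := eqf y; rewrite !inE !eqxx orbT /=.
  case/esym/orP=> /eqP Dy /esym/orP[]/eqP Dx; move: lt1 lt2;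
    by rewrite Dx Dy ?ltnn // => lt1 /(ltn_trans lt1); rewrite ltnn.
rewrite -(card_in_imset injf) -cards_draws; apply/subset_leq_card/subsetP.
move=> _ /imsetP[[x y] + ->]; rewrite !inE /= => /andP[/andP[xO yO] lt_xy].
rewrite subUset !sub1set xO yO cards2.
by rewrite (_ : x != y) //; apply: contraTneq lt_xy => ->; rewrite ltnn.
Qed.

Definition used_layers : {set 'I_r} :=
  \bigcup_(xy in ascents) [set c in stays xy.1 (behead (P xy.1 xy.2))].

Lemma card_used_layers : #|used_layers| <= diam e * 'C(#|Omega|, 2).
Proof.
rewrite mulnC; apply: leq_trans (leq_mul card_ascents (leqnn _)).
rewrite -sum_nat_const /used_layers.
(* [K] lets [big_ind2] compare the union with the sum of the bounds. *)
pose K (A : {set 'I_r}) n := #|A| <= n.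
apply: (big_ind2 K) => [|A m B n Am Bn|[x y]]; rewrite /K ?cards0 //.
  by apply: leq_trans (leq_card_setU _ _) (leq_add Am Bn).
rewrite !inE /= => /andP[/andP[xO yO] /ltnW le_xy].
rewrite cardsE; apply: leq_trans (card_size _) _.
by case: (choiceP xO yO) => /geodesic_stays/(_ le_xy).
Qed.

Lemma free_layer : diam e * 'C(#|Omega|, 2) + #|Omega| < r ->
  exists c, c \notin used_layers /\ {in Omega, forall x, x.1 != c}.
Proof.
move=> lt_r; pose B := used_layers :|: [set x.1 | x in Omega].
have lt_B : #|B| < r.
  apply: leq_ltn_trans lt_r; apply: leq_trans (leq_card_setU _ _) _.
  by rewrite leq_add ?card_used_layers ?leq_imset_card.
case: (pickP [predC B]) => [c | BT].
  rewrite !inE negb_or => /andP[cU /imsetP cO]; exists c; split=> // x xO.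
  by apply/eqP => Dc; apply: cO; exists x.
suff DB : B = setT by move: lt_B; rewrite DB cardsT card_ord ltnn.
by apply/setP => c; rewrite in_setT; apply: negbFE (BT c).
Qed.

Hypothesis coverP : forall v,
  exists x y, [/\ x \in Omega, y \in Omega & v \in P x y].

Lemma card_le_sides c : c \notin used_layers -> {in Omega, forall x, x.1 != c} ->
  #|T| <= #|[set x in Omega | x.1 < c]| * #|[set x in Omega | c < x.1]|.
Proof.
move=> free_c cO; set L := [set x in _ | _]; set R := [set x in _ | _].
have crossP x y : x \in Omega -> y \in Omega -> x.1 < y.1 ->
    sorted (crosses c) (P x y).
  move=> xO yO lt_xy; case: (choiceP xO yO) => gP _.
  apply: geodesic_crosses gP (ltnW lt_xy) _; apply: contra free_c => cP.
  by apply/bigcupP; exists (x, y); rewrite ?inE ?xO ?yO.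
have sidesP g : exists xy : V * V, xy \in setX L R /\ (c, g) \in P xy.1 xy.2.
  have [x [y [xO yO]]] := coverP (c, g).
  (* The geodesic selected for the swapped pair is the reversal, with the same vertices. *)
  wlog le_xy : x y xO yO / x.1 <= y.1.
    move=> IH; case: (leqP x.1 y.1) => [le_xy | /ltnW le_yx]; first exact: IH.
    by case: (choiceP yO xO) => _ ->; rewrite mem_rev; apply: IH.
  move=> gP; exists (x, y); split=> //; rewrite !inE xO yO !ltn_neqAle /=.
  rewrite (inj_eq val_inj) cO // eq_sym (inj_eq val_inj) cO //=.
  by case: (choiceP xO yO) => /geodesic_between/(_ le_xy gP).
have [f fP] := choice sidesP.
(* Equal end pairs give one selected geodesic, which meets layer [c] at most once. *)
have inj_f : injective f.
  move=> g h Dfg; have [] := fP g; have [] := fP h.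
  rewrite -Dfg; case: (f g) => x y /= _ hP; rewrite !inE /= => xy gP.
  case/andP: xy => /andP[xO xc] /andP[yO cy].
  exact: sorted_crosses_inj (crossP _ _ xO yO (ltn_trans xc cy)) gP hP.
rewrite -cardsX -(card_imset _ inj_f); apply/subset_leq_card/subsetP => xy.
by case/imsetP=> g _ ->; case: (fP g).
Qed.

Lemma card_le_square : diam e * 'C(#|Omega|, 2) + #|Omega| < r ->
  4 * #|T| <= #|Omega| ^ 2.
Proof.
case/free_layer=> c [free_c cO]; have := card_le_sides free_c cO.
set L := [set x in _ | _]; set R := [set x in _ | _].
have : #|L| + #|R| <= #|Omega|.
  have := leq_card_setU L R; rewrite /leqif.
  have -> : [disjoint L & R].
    by apply/pred0P => x; rewrite !inE /=; case: ltngtP; rewrite !andbF.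
  case=> _ /eqP <-; apply/subset_leq_card/subsetP => x.
  by rewrite !inE => /orP[]/andP[].
(* By the AM-GM inequality, [4 * (#|L| * #|R|) <= (#|L| + #|R|) ^ 2]. *)
move=> le_LR le_T; apply: leq_trans (_ : (#|L| + #|R|) ^ 2 <= _).
  by apply: leq_trans (nat_AGM2 _ _); rewrite leq_pmul2l.
by rewrite leq_exp2r.
Qed.

End Layers.

Import Order.TTheory GRing.Theory Num.Theory.

Theorem theorem2p4 (R : realType) (T : finType) (e : rel T) (r : nat)
    (Omega : {set 'I_r * T}) :
  simple_graph e -> connected_graph e -> 1 <= r ->
  minimum_strong_geodetic_set (cart_prod (path_graph r) e) Omega ->
  diam e * 'C(#|Omega|, 2) + #|Omega| < r ->
  (Num.ceil (2 * Num.sqrt (#|T|%:R : R))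
     <= (sg (cart_prod (path_graph r) e))%:Z)%R.
Proof.
move=> _ conn_e _ minO; rewrite (sg_minimum minO).
case: minO => [[P choiceP coverP] _] /(card_le_square conn_e choiceP coverP).
rewrite ceil_le_int -(ler_nat R) natrM natrX => le_T.
rewrite -(@ler_pXn2r _ 2) ?nnegrE ?mulr_ge0 ?sqrtr_ge0 //.
by rewrite exprMn sqr_sqrtr // -natrX.
Qed.
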